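(* Every sequent derivable in $\mathsf{L^m_{RBL}}$ has a derivation in $\mathsf{L^m_{RBL}}$ that does not use $(\mathrm{Mix})$, except for applications of $(\mathrm{Mix})$ whose mix formula is $\bot$ or $\top$.
   Context: $\mathcal{L}_{\mathrm{RBL}}$-formulae are built from propositional letters $p$ by $A::=p\mid\bot\mid\top\mid A\wedge A\mid A\vee A\mid A\cdot A\mid A\rightarrow A\mid A\leftarrow A$. Formula structures: every formula is a formula structure, and if $\Gamma,\Delta$ are formula structures then so are $\Gamma\odot\Delta$ (structural counterpart of $\cdot$) and $\Gamma\mathbin{\bar{\wedge}}\Delta$ (structural counterpart of $\wedge$; written as a circled wedge in the paper). Sequents are $\Gamma\Rightarrow A$ with $\Gamma$ a formula structure and $A$ a formula; $\Gamma[\Delta]$ denotes a structure with a distinguished substructure occurrence $\Delta$. The sequent calculus $\mathsf{L_{RBL}}$ has axioms $A\Rightarrow A$, $A\Rightarrow\top$, $\bot\Rightarrow A$ and rules: $(\rightarrow L)$ from $\Delta\Rightarrow A$ and $\Gamma[B]\Rightarrow C$ infer $\Gamma[\Delta\odot(A\rightarrow B)]\Rightarrow C$; $(\rightarrow R)$ from $A\odot\Gamma\Rightarrow B$ infer $\Gamma\Rightarrow A\rightarrow B$; $(\leftarrow L)$ from $\Gamma[A]\Rightarrow C$ and $\Delta\Rightarrow B$ infer $\Gamma[(A\leftarrow B)\odot\Delta]\Rightarrow C$; $(\leftarrow R)$ from $\Gamma\odot B\Rightarrow A$ infer $\Gamma\Rightarrow A\leftarrow B$ (in $(\rightarrow R),(\leftarrow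 R)$, $\Gamma$ must be nonempty); $(\cdot L)$ from $\Gamma[A\odot B]\Rightarrow C$ infer $\Gamma[A\cdot B]\Rightarrow C$; $(\cdot R)$ from $\Gamma\Rightarrow A$ and $\Delta\Rightarrow B$ infer $\Gamma\odot\Delta\Rightarrow A\cdot B$; $(\wedge L)$ from $\Gamma[A\mathbin{\bar{\wedge}}B]\Rightarrow C$ infer $\Gamma[A\wedge B]\Rightarrow C$; $(\wedge R)$ from $\Gamma\Rightarrow A$ and $\Gamma\Rightarrow B$ infer $\Gamma\Rightarrow A\wedge B$; $(\vee L)$ from $\Gamma[A]\Rightarrow C$ and $\Gamma[B]\Rightarrow C$ infer $\Gamma[A\vee B]\Rightarrow C$; $(\vee R)$ from $\Gamma\Rightarrow A_i$ infer $\Gamma\Rightarrow A_1\vee A_2$ ($i=1,2$); contraction: from $\Gamma[\Delta\mathbin{\bar{\wedge}}\Delta]\Rightarrow A$ infer $\Gamma[\Delta]\Rightarrow A$; restricted $\odot$-contraction: from $\Gamma[(\Lambda\odot\Delta)\odot\Delta]\Rightarrow A$ infer $\Gamma[\Lambda\odot\Delta]\Rightarrow A$ ($\Lambda$ nonempty); exchange: from $\Gamma[\Delta\mathbin{\bar{\wedge}}\Lambda]\Rightarrow A$ infer $\Gamma[\Lambda\mathbin{\bar{\wedge}}\Delta]\Rightarrow A$; associativity of $\mathbin{\bar{\wedge}}$ in both directions: $\Gamma[(\Delta_1\mathbin{\bar{\wedge}}\Delta_2)\mathbin{\bar{\wedge}}\Delta_3]\Rightarrow A$ and $\Gamma[\Delta_1\mathbin{\bar{\wedge}}(\Delta_2\mathbin{\bar{\wedge}}\Delta_3)]\Rightarrow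 A$ are interderivable; weakening: from $\Gamma[\Delta]\Rightarrow A$ infer $\Gamma[\Delta'*\Delta]\Rightarrow A$ and $\Gamma[\Delta*\Delta']\Rightarrow A$ for $*\in\{\mathbin{\bar{\wedge}},\odot\}$; $(\mathrm{Cut})$ from $\Delta\Rightarrow A$ and $\Gamma[A]\Rightarrow B$ infer $\Gamma[\Delta]\Rightarrow B$. $\mathsf{L^m_{RBL}}$ is $\mathsf{L_{RBL}}$ with $(\mathrm{Cut})$ replaced by $(\mathrm{Mix})$: from $\Delta\Rightarrow A$ and $\Gamma[A]\ldots[A]\Rightarrow B$ infer $\Gamma[\Delta]\ldots[\Delta]\Rightarrow B$, where $\Gamma[A]\ldots[A]$ contains at least one occurrence of $A$ and at least one occurrence of $A$ is replaced by $\Delta$. $\mathsf{L^m_{RBL}}$ derives the same sequents as $\mathsf{L_{RBL}}$. *)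

(* Defs.v *)
From Stdlib Require Import List.

Set Implicit Arguments.

Inductive formula (V : Type) : Type :=
| Var : V -> formula V
| Bot : formula V
| Top : formula V
| And : formula V -> formula V -> formula V
| Or : formula V -> formula V -> formula V
| Dot : formula V -> formula V -> formula V
| RImp : formula V -> formula V -> formula V
| LImp : formula V -> formula V -> formula V.

Arguments Bot {V}.
Arguments Top {V}.

Declare Scope rbl_scope.
Delimit Scope rbl_scope with rbl.

Notation "⊥" := Bot (at level 0) : rbl_scope.
Notation "⊤" := Top (at level 0) : rbl_scope.
Notation "A ∧ B" := (And A B) (at level 40, left associativity) : rbl_scope.
Notation "A ∨ B" := (Or A B) (at level 40, left associativity) : rbl_scope.
Notation "A · B" := (Dot A B) (at level 40, left associativity) : rbl_scope.
Notation "A → B" := (RImp A B) (at level 45, no associativity) : rbl_scope.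
Notation "A ← B" := (LImp A B) (at level 45, no associativity) : rbl_scope.

(** There is no empty structure, so the nonemptiness side conditions on
    ([→R]), ([←R]) and restricted [⊙]-contraction hold automatically. *)
Inductive structure (V : Type) : Type :=
| Leaf : formula V -> structure V
| SDot : structure V -> structure V -> structure V
| SAnd : structure V -> structure V -> structure V.

Coercion Leaf : formula >-> structure.

Notation "G ⊙ D" := (SDot G D) (at level 50, left associativity) : rbl_scope.
Notation "G ⩓ D" := (SAnd G D) (at level 50, left associativity) : rbl_scope.

Open Scope rbl_scope.

(** Structures with exactly one hole. *)
Inductive context (V : Type) : Type :=
| Hole : context V
| CDotL : context V -> structure V -> context V
| CDotR : structure V -> context V -> context V
| CAndL : context V -> structure V -> context V
| CAndR : structure V -> context V -> context V.

Fixpoint fill (V : Type) (G : context V) (D : structure V) : structure V :=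
  match G with
  | Hole _ => D
  | CDotL G1 G2 => fill G1 D ⊙ G2
  | CDotR G1 G2 => G1 ⊙ fill G2 D
  | CAndL G1 G2 => fill G1 D ⩓ G2
  | CAndR G1 G2 => G1 ⩓ fill G2 D
  end.

Notation "G [[ D ]]" := (fill G D)
  (at level 2, left associativity, format "G [[ D ]]") : rbl_scope.

(** Structures with any number of holes, for [Γ[A]...[A]] in (Mix). *)
Inductive mcontext (V : Type) : Type :=
| MHole : mcontext V
| MLeaf : formula V -> mcontext V
| MDot : mcontext V -> mcontext V -> mcontext V
| MAnd : mcontext V -> mcontext V -> mcontext V.

Fixpoint mfill (V : Type) (M : mcontext V) (D : structure V) : structure V :=
  match M with
  | MHole _ => D
  | MLeaf A => A
  | MDot M1 M2 => mfill M1 D ⊙ mfill M2 D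
  | MAnd M1 M2 => mfill M1 D ⩓ mfill M2 D
  end.

Fixpoint holes (V : Type) (M : mcontext V) : nat :=
  match M with
  | MHole _ => 1
  | MLeaf _ => 0
  | MDot M1 M2 | MAnd M1 M2 => holes M1 + holes M2
  end.

(** [Lm G A] is the type of derivations of the sequent [G ⇒ A] in the calculus
    with (Mix).  In [Mix], the holes of [M] are the replaced occurrences of the
    mix formula [A]; further occurrences of [A] may sit at leaves of [M] and
    are left unchanged. *)
Inductive Lm (V : Type) : structure V -> formula V -> Type :=
| Ax (A : formula V) : Lm A A
| TopAx (A : formula V) : Lm A ⊤
| BotAx (A : formula V) : Lm ⊥ A
| RImpL (G : context V) (D : structure V) (A B C : formula V) :
    Lm D A -> Lm G[[B]] C -> Lm G[[D ⊙ (A → B)]] C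
| RImpR (G : structure V) (A B : formula V) :
    Lm (A ⊙ G) B -> Lm G (A → B)
| LImpL (G : context V) (D : structure V) (A B C : formula V) :
    Lm G[[A]] C -> Lm D B -> Lm G[[(A ← B) ⊙ D]] C
| LImpR (G : structure V) (A B : formula V) :
    Lm (G ⊙ B) A -> Lm G (A ← B)
| DotL (G : context V) (A B C : formula V) :
    Lm G[[A ⊙ B]] C -> Lm G[[A · B]] C
| DotR (G D : structure V) (A B : formula V) :
    Lm G A -> Lm D B -> Lm (G ⊙ D) (A · B)
| AndL (G : context V) (A B C : formula V) :
    Lm G[[A ⩓ B]] C -> Lm G[[A ∧ B]] C
| AndR (G : structure V) (A B : formula V) :
    Lm G A -> Lm G B -> Lm G (A ∧ B)
| OrL (G : context V) (A B C : formula V) :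
    Lm G[[A]] C -> Lm G[[B]] C -> Lm G[[A ∨ B]] C
| OrR1 (G : structure V) (A B : formula V) :
    Lm G A -> Lm G (A ∨ B)
| OrR2 (G : structure V) (A B : formula V) :
    Lm G B -> Lm G (A ∨ B)
| AndContr (G : context V) (D : structure V) (A : formula V) :
    Lm G[[D ⩓ D]] A -> Lm G[[D]] A
| DotContr (G : context V) (L D : structure V) (A : formula V) :
    Lm G[[(L ⊙ D) ⊙ D]] A -> Lm G[[L ⊙ D]] A
| AndExch (G : context V) (D L : structure V) (A : formula V) :
    Lm G[[D ⩓ L]] A -> Lm G[[L ⩓ D]] A
| AndAssocR (G : context V) (D1 D2 D3 : structure V) (A : formula V) :
    Lm G[[(D1 ⩓ D2) ⩓ D3]] A -> Lm G[[D1 ⩓ (D2 ⩓ D3)]] A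
| AndAssocL (G : context V) (D1 D2 D3 : structure V) (A : formula V) :
    Lm G[[D1 ⩓ (D2 ⩓ D3)]] A -> Lm G[[(D1 ⩓ D2) ⩓ D3]] A
| AndWeakL (G : context V) (D D' : structure V) (A : formula V) :
    Lm G[[D]] A -> Lm G[[D' ⩓ D]] A
| AndWeakR (G : context V) (D D' : structure V) (A : formula V) :
    Lm G[[D]] A -> Lm G[[D ⩓ D']] A
| DotWeakL (G : context V) (D D' : structure V) (A : formula V) :
    Lm G[[D]] A -> Lm G[[D' ⊙ D]] A
| DotWeakR (G : context V) (D D' : structure V) (A : formula V) :
    Lm G[[D]] A -> Lm G[[D ⊙ D']] A
| Mix (M : mcontext V) (D : structure V) (A B : formula V) :
    1 <= holes M -> Lm D A -> Lm (mfill M A) B -> Lm (mfill M D) B.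

Fixpoint mix_formulas (V : Type) (G : structure V) (A : formula V)
    (d : Lm G A) : list (formula V) :=
  match d with
  | Ax _ | TopAx _ | BotAx _ => nil
  | RImpR d1 | LImpR d1 | OrR1 _ d1 | OrR2 _ d1
  | DotL _ _ _ d1 | AndL _ _ _ d1
  | AndContr _ _ d1 | DotContr _ _ _ d1 | AndExch _ _ _ d1
  | AndAssocR _ _ _ _ d1 | AndAssocL _ _ _ _ d1
  | AndWeakL _ _ _ d1 | AndWeakR _ _ _ d1
  | DotWeakL _ _ _ d1 | DotWeakR _ _ _ d1 => mix_formulas d1
  | RImpL _ _ d1 d2 | LImpL _ _ d1 d2 | OrL _ _ _ d1 d2
  | DotR d1 d2 | AndR d1 d2 => mix_formulas d1 ++ mix_formulas d2
  | @Mix _ _ _ C _ _ d1 d2 => C :: mix_formulas d1 ++ mix_formulas d2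
  end.

(* Main.v *)
Require Import Defs.
From Stdlib Require Import List.

Set Implicit Arguments.

(** Every instance of (Mix) can be eliminated, even on [⊥] and [⊤].  Call a cut of
    [D ⇒ A] into [K[A] ⇒ C] principal if [D ⇒ A] ends in a right rule or is
    an instance of [A ⇒ ⊤].  A non-principal cut is permuted upwards in the
    derivation of [D ⇒ A], replacing one occurrence of [A] at a time because
    ([∨L]) has two premises.  For a principal cut, [D] obeys the left rules of
    [A], by cuts on the immediate subformulas of [A]; hence any set of
    occurrences of [A] can be replaced by [D], by induction on the derivation
    of [K[A] ⇒ C].  Replacing several occurrences at once absorbs the two
    contraction rules. *)

(** * Derivability without (Mix) *)

(** The pairs (premise, conclusion) of the one-premise left rules, without
    their surrounding context. *)
Inductive left_step (V : Type) : structure V -> structure V -> Prop :=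
| step_Dot (A B : formula V) : left_step (A ⊙ B) (A · B)
| step_And (A B : formula V) : left_step (A ⩓ B) (A ∧ B)
| step_AndContr (D : structure V) : left_step (D ⩓ D) D
| step_DotContr (L D : structure V) : left_step ((L ⊙ D) ⊙ D) (L ⊙ D)
| step_AndExch (D L : structure V) : left_step (D ⩓ L) (L ⩓ D)
| step_AndAssocR (D1 D2 D3 : structure V) :
    left_step ((D1 ⩓ D2) ⩓ D3) (D1 ⩓ (D2 ⩓ D3))
| step_AndAssocL (D1 D2 D3 : structure V) :
    left_step (D1 ⩓ (D2 ⩓ D3)) ((D1 ⩓ D2) ⩓ D3)
| step_AndWeakL (D D' : structure V) : left_step D (D' ⩓ D)
| step_AndWeakR (D D' : structure V) : left_step D (D ⩓ D')
| step_DotWeakL (D D' : structure V) : left_step D (D' ⊙ D)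
| step_DotWeakR (D D' : structure V) : left_step D (D ⊙ D').

(** All one-premise left rules are gathered in [mf_step], so a cut is permuted past any of them in a
    single case. *)
Inductive mix_free (V : Type) : structure V -> formula V -> Prop :=
| mf_Ax (A : formula V) : mix_free A A
| mf_Top (A : formula V) : mix_free A ⊤
| mf_Bot (A : formula V) : mix_free ⊥ A
| mf_RImpL (K : context V) (D : structure V) (A B C : formula V) :
    mix_free D A -> mix_free K[[Leaf B]] C -> mix_free K[[D ⊙ (A → B)]] C
| mf_RImpR (G : structure V) (A B : formula V) :
    mix_free (A ⊙ G) B -> mix_free G (A → B)
| mf_LImpL (K : context V) (D : structure V) (A B C : formula V) :
    mix_free K[[Leaf A]] C -> mix_free D B -> mix_free K[[(A ← B) ⊙ D]] C
| mf_LImpR (G : structure V) (A B : formula V) :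
    mix_free (G ⊙ B) A -> mix_free G (A ← B)
| mf_DotR (G D : structure V) (A B : formula V) :
    mix_free G A -> mix_free D B -> mix_free (G ⊙ D) (A · B)
| mf_AndR (G : structure V) (A B : formula V) :
    mix_free G A -> mix_free G B -> mix_free G (A ∧ B)
| mf_OrL (K : context V) (A B C : formula V) :
    mix_free K[[Leaf A]] C -> mix_free K[[Leaf B]] C -> mix_free K[[Leaf (A ∨ B)]] C
| mf_OrR1 (G : structure V) (A B : formula V) :
    mix_free G A -> mix_free G (A ∨ B)
| mf_OrR2 (G : structure V) (A B : formula V) :
    mix_free G B -> mix_free G (A ∨ B)
| mf_step (K : context V) (X Y : structure V) (C : formula V) :
    left_step X Y -> mix_free K[[X]] C -> mix_free K[[Y]] C.

Lemma mix_free_Lm (V : Type) (G : structure V) (A : formula V) :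
  mix_free G A -> exists d : Lm G A, mix_formulas d = nil.
Proof.
  assert (Happ : forall l l' : list (formula V),
             l = nil -> l' = nil -> l ++ l' = nil)
    by (intros l l' -> ->; reflexivity).
  induction 1 as
    [ A | A | A
    | K D A B C _ [d1 H1] _ [d2 H2] | G A B _ [d1 H1]
    | K D A B C _ [d1 H1] _ [d2 H2] | G A B _ [d1 H1]
    | G D A B _ [d1 H1] _ [d2 H2] | G A B _ [d1 H1] _ [d2 H2]
    | K A B C _ [d1 H1] _ [d2 H2] | G A B _ [d1 H1] | G A B _ [d1 H1]
    | K X Y C HXY _ [d1 H1] ].
  - now exists (Ax A).
  - now exists (TopAx A).
  - now exists (BotAx A).
  - exists (RImpL K B d1 d2); simpl; auto.
  - now exists (RImpR d1).
  - exists (LImpL K A d1 d2); simpl; auto.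
  - now exists (LImpR d1).
  - exists (DotR d1 d2); simpl; auto.
  - exists (AndR d1 d2); simpl; auto.
  - exists (OrL K A B d1 d2); simpl; auto.
  - now exists (OrR1 B d1).
  - now exists (OrR2 A d1).
  - destruct HXY.
    + now exists (DotL K A B d1).
    + now exists (AndL K A B d1).
    + now exists (AndContr K D d1).
    + now exists (DotContr K L D d1).
    + now exists (AndExch K D L d1).
    + now exists (AndAssocR K D1 D2 D3 d1).
    + now exists (AndAssocL K D1 D2 D3 d1).
    + now exists (AndWeakL K D D' d1).
    + now exists (AndWeakR K D D' d1).
    + now exists (DotWeakL K D D' d1).
    + now exists (DotWeakR K D D' d1).
Qed.

(** * Composition of contexts and weakening *)

Fixpoint ctx_comp (V : Type) (K K' : context V) : context V :=
  match K with
  | Hole _ => K'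
  | CDotL K1 G => CDotL (ctx_comp K1 K') G
  | CDotR G K1 => CDotR G (ctx_comp K1 K')
  | CAndL K1 G => CAndL (ctx_comp K1 K') G
  | CAndR G K1 => CAndR G (ctx_comp K1 K')
  end.

Lemma fill_comp (V : Type) (K K' : context V) (X : structure V) :
  (ctx_comp K K')[[X]] = K[[K'[[X]]]].
Proof. induction K; simpl; congruence. Qed.

Lemma mix_free_weaken (V : Type) (K : context V) (X : structure V) (A : formula V) :
  mix_free X A -> mix_free K[[X]] A.
Proof.
  intros HX; induction K; simpl; trivial.
  - now apply (mf_step (Hole V) (step_DotWeakR _ _)).
  - now apply (mf_step (Hole V) (step_DotWeakL _ _)).
  - now apply (mf_step (Hole V) (step_AndWeakR _ _)).
  - now apply (mf_step (Hole V) (step_AndWeakL _ _)).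
Qed.

(** The axiom for [⊤] has a single formula on the left; weakening builds the rest of [D] around one
    of its leaves. *)
Lemma mix_free_top (V : Type) (D : structure V) : mix_free D ⊤.
Proof.
  induction D as [A | D1 IH1 D2 _ | D1 IH1 D2 _].
  - apply mf_Top.
  - exact (mix_free_weaken (CDotL (Hole V) D2) IH1).
  - exact (mix_free_weaken (CAndL (Hole V) D2) IH1).
Qed.

(** * Replacing occurrences of a formula by a structure *)

(** [repl A D S S'] : [S'] arises from [S] by replacing some, possibly no,
    occurrences of the leaf [A] by [D]. *)
Inductive repl (V : Type) (A : formula V) (D : structure V) :
  structure V -> structure V -> Prop :=
| repl_leaf (B : formula V) : repl A D (Leaf B) (Leaf B)
| repl_here : repl A D (Leaf A) D
| repl_Dot (X X' Y Y' : structure V) :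
    repl A D X X' -> repl A D Y Y' -> repl A D (X ⊙ Y) (X' ⊙ Y')
| repl_And (X X' Y Y' : structure V) :
    repl A D X X' -> repl A D Y Y' -> repl A D (X ⩓ Y) (X' ⩓ Y').

Lemma repl_refl (V : Type) (A : formula V) (D X : structure V) : repl A D X X.
Proof. induction X; constructor; trivial. Qed.

Lemma repl_fill (V : Type) (A : formula V) (D : structure V) (K : context V)
    (X Y : structure V) :
  repl A D X Y -> repl A D K[[X]] K[[Y]].
Proof.
  intros HXY; induction K; simpl; trivial; constructor; auto using repl_refl.
Qed.

Lemma repl_mfill (V : Type) (A : formula V) (D : structure V) (M : mcontext V) :
  repl A D (mfill M A) (mfill M D).
Proof. induction M; simpl; constructor; trivial. Qed.

Lemma repl_Leaf_inv (V : Type) (A B : formula V) (D S : structure V) :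
  repl A D (Leaf B) S -> S = Leaf B \/ B = A /\ S = D.
Proof. inversion 1; auto. Qed.

(** Replacements in the context and in the hole are independent. The last clause carries those in
    the context over to the premises of a left rule, which put other structures in the hole. *)
Lemma repl_fill_inv (V : Type) (A : formula V) (D : structure V)
    (K : context V) (X T : structure V) :
  repl A D K[[X]] T ->
  exists K' X', T = K'[[X']] /\ repl A D X X' /\
    forall Y Y', repl A D Y Y' -> repl A D K[[Y]] K'[[Y']].
Proof.
  revert T; induction K as [| K IH Z | Z K IH | K IH Z | Z K IH];
    simpl; intros T HT.
  1: now exists (Hole V), T.
  all: inversion HT; subst.
  - destruct (IH _ H1) as (K' & X'' & -> & HX & HK).
    exists (CDotL K' Y'), X''; repeat split; trivial.
    intros; simpl; constructor; auto.
  - destruct (IH _ H3) as (K' & X'' & -> & HX & HK).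
    exists (CDotR X' K'), X''; repeat split; trivial.
    intros; simpl; constructor; auto.
  - destruct (IH _ H1) as (K' & X'' & -> & HX & HK).
    exists (CAndL K' Y'), X''; repeat split; trivial.
    intros; simpl; constructor; auto.
  - destruct (IH _ H3) as (K' & X'' & -> & HX & HK).
    exists (CAndR X' K'), X''; repeat split; trivial.
    intros; simpl; constructor; auto.
Qed.

(** * Principal cuts *)

(** [D] obeys the left rules of [A].  The values at letters and [⊥], which no
    right rule introduces, rule these formulas out. *)
Definition acts_as (V : Type) (D : structure V) (A : formula V) : Prop :=
  match A with
  | Var _ | Bot => False
  | Top => True
  | And A B => forall K C, mix_free K[[A ⩓ B]] C -> mix_free K[[D]] C
  | Or A B => forall K C,
      mix_free K[[Leaf A]] C -> mix_free K[[Leaf B]] C -> mix_free K[[D]] C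
  | Dot A B => forall K C, mix_free K[[A ⊙ B]] C -> mix_free K[[D]] C
  | RImp A B => forall K E C,
      mix_free E A -> mix_free K[[Leaf B]] C -> mix_free K[[E ⊙ D]] C
  | LImp A B => forall K E C,
      mix_free K[[Leaf A]] C -> mix_free E B -> mix_free K[[D ⊙ E]] C
  end.

(** If the principal formula of the step is itself replaced, [acts_as] supplies the inference;
    otherwise the same rule applies after the replacement. *)
Lemma left_step_repl (V : Type) (A : formula V) (D X Y Y' : structure V) :
  acts_as D A -> left_step X Y -> repl A D Y Y' ->
  exists X', repl A D X X' /\
    forall K C, mix_free K[[X']] C -> mix_free K[[Y']] C.
Proof.
  intros HD HXY HY; destruct HXY.
  - exists (A0 ⊙ B); split; [apply repl_refl|].
    destruct (repl_Leaf_inv HY) as [-> | [<- ->] ]; trivial.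
    intros K C; apply mf_step; constructor.
  - exists (A0 ⩓ B); split; [apply repl_refl|].
    destruct (repl_Leaf_inv HY) as [-> | [<- ->] ]; trivial.
    intros K C; apply mf_step; constructor.
  (* Both copies receive the replacement made in the contracted structure, so one occurrence below
     may become two above. *)
  - exists (Y' ⩓ Y'); split; [now constructor|].
    intros K C; apply mf_step; constructor.
  - inversion HY; subst.
    exists ((X' ⊙ Y'0) ⊙ Y'0); split; [now repeat constructor|].
    intros K C; apply mf_step; constructor.
  - inversion HY; subst.
    exists (Y'0 ⩓ X'); split; [now constructor|].
    intros K C; apply mf_step; constructor.
  - inversion HY as [| | |X1 X1' X2 X2' H1 H2]; subst.
    inversion H2 as [| | |X3 X3' X4 X4' H3 H4]; subst.
    exists ((X1' ⩓ X3') ⩓ X4'); split; [now repeat constructor|].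
    intros K C; apply mf_step; constructor.
  - inversion HY as [| | |X1 X1' X2 X2' H1 H2]; subst.
    inversion H1 as [| | |X3 X3' X4 X4' H3 H4]; subst.
    exists (X3' ⩓ (X4' ⩓ X2')); split; [now repeat constructor|].
    intros K C; apply mf_step; constructor.
  - inversion HY; subst.
    exists Y'0; split; trivial; intros K C; apply mf_step; constructor.
  - inversion HY; subst.
    exists X'; split; trivial; intros K C; apply mf_step; constructor.
  - inversion HY; subst.
    exists Y'0; split; trivial; intros K C; apply mf_step; constructor.
  - inversion HY; subst.
    exists X'; split; trivial; intros K C; apply mf_step; constructor.
Qed.

Lemma mix_free_repl (V : Type) (A : formula V) (D S : structure V) (C : formula V) :
  mix_free D A -> acts_as D A -> mix_free S C ->
  forall S', repl A D S S' -> mix_free S' C.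
Proof.
  intros HD HA HS.
  induction HS as
    [ B | B | B
    | K E B1 B2 C H1 IH1 H2 IH2 | G B1 B2 H1 IH1
    | K E B1 B2 C H1 IH1 H2 IH2 | G B1 B2 H1 IH1
    | G E B1 B2 H1 IH1 H2 IH2 | G B1 B2 H1 IH1 H2 IH2
    | K B1 B2 C H1 IH1 H2 IH2 | G B1 B2 H1 IH1 | G B1 B2 H1 IH1
    | K X Y C HXY H1 IH1 ]; intros S' HR.
  - destruct (repl_Leaf_inv HR) as [-> | [-> ->] ]; trivial; constructor.
  - apply mix_free_top.
  - destruct (repl_Leaf_inv HR) as [-> | [<- ->] ]; [constructor | destruct HA].
  - destruct (repl_fill_inv _ _ HR) as (K' & X' & -> & HX & HK).
    inversion HX as [| |X1 E' X2 Z HE HZ|]; subst.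
    specialize (IH1 _ HE).
    (* The auxiliary formula [B2] stays in the hole, even if it equals [A]. *)
    specialize (IH2 _ (HK _ _ (repl_leaf _ _ _))).
    destruct (repl_Leaf_inv HZ) as [-> | [<- ->] ]; [|now apply HA].
    now apply mf_RImpL.
  - apply mf_RImpR, IH1; repeat constructor; trivial.
  - destruct (repl_fill_inv _ _ HR) as (K' & X' & -> & HX & HK).
    inversion HX as [| |X1 Z X2 E' HZ HE|]; subst.
    specialize (IH2 _ HE).
    specialize (IH1 _ (HK _ _ (repl_leaf _ _ _))).
    destruct (repl_Leaf_inv HZ) as [-> | [<- ->] ]; [|now apply HA].
    now apply mf_LImpL.
  - apply mf_LImpR, IH1; repeat constructor; trivial.
  - inversion HR; subst; apply mf_DotR; auto.
  - apply mf_AndR; auto.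
  - destruct (repl_fill_inv _ _ HR) as (K' & X' & -> & HX & HK).
    specialize (IH1 _ (HK _ _ (repl_leaf _ _ _))).
    specialize (IH2 _ (HK _ _ (repl_leaf _ _ _))).
    destruct (repl_Leaf_inv HX) as [-> | [<- ->] ]; [|now apply HA].
    now apply mf_OrL.
  - apply mf_OrR1; auto.
  - apply mf_OrR2; auto.
  - destruct (repl_fill_inv _ _ HR) as (K' & Y' & -> & HY & HK).
    destruct (left_step_repl HA HXY HY) as (X' & HX & Hstep); auto.
Qed.

(** * Cut admissibility by induction on the cut formula *)

(** With two occurrences cut at once, permuting past (∨L) would need premises with different
    disjuncts in the two copies of [D], which the induction hypotheses do not give. *)
Definition cut_admissible (V : Type) (A : formula V) : Prop :=
  forall D K C, mix_free D A -> mix_free K[[Leaf A]] C -> mix_free K[[D]] C.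

Definition subformula_cuts (V : Type) (A : formula V) : Prop :=
  match A with
  | Var _ | Bot | Top => True
  | And A B | Or A B | Dot A B | RImp A B | LImp A B =>
      cut_admissible A /\ cut_admissible B
  end.

Lemma principal_cut (V : Type) (A : formula V) (D : structure V) :
  mix_free D A -> acts_as D A ->
  forall K C, mix_free K[[Leaf A]] C -> mix_free K[[D]] C.
Proof.
  intros HD HA K C HK.
  apply (mix_free_repl HD HA HK), repl_fill, repl_here.
Qed.

Lemma cut_admissible_step (V : Type) (A : formula V) :
  subformula_cuts A -> cut_admissible A.
Proof.
  intros Hsub D K C HD; revert K C.
  induction HD as
    [ B | B | B
    | K' E B1 B2 A H1 _ H2 IH2 | G B1 B2 H1 _
    | K' E B1 B2 A H1 IH1 H2 _ | G B1 B2 H1 _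
    | G E B1 B2 H1 _ H2 _ | G B1 B2 H1 _ H2 _
    | K' B1 B2 A H1 IH1 H2 IH2 | G B1 B2 H1 _ | G B1 B2 H1 _
    | K' X Y A HXY H1 IH1 ]; intros K C.
  - trivial.
  (* [⊤] has no left rule for [D] to obey. *)
  - apply principal_cut; [constructor | exact I].
  (* Here [D] is [⊥], which yields [C] by itself. *)
  - intros _; apply mix_free_weaken; constructor.
  (* The left rule acting inside [K'] is applied below the cut, in the composite of [K] and [K']. *)
  - intros HK; rewrite <- fill_comp; apply mf_RImpL; trivial.
    rewrite fill_comp; auto.
  - apply principal_cut; [now constructor|].
    destruct Hsub as [Hc1 Hc2]; intros K' E C' HE HB.
    (* The premise [B1 ⊙ G ⇒ B2] is cut on [B2]; then the exposed [B1] is cut against [E ⇒ B1]. *)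
    assert (H : mix_free K'[[B1 ⊙ G]] C') by now apply Hc2.
    change (mix_free K'[[(CDotL (Hole V) G)[[Leaf B1]]]] C') in H.
    rewrite <- fill_comp in H.
    apply (Hc1 _ _ _ HE) in H; now rewrite fill_comp in H.
  - intros HK; rewrite <- fill_comp; apply mf_LImpL; trivial.
    rewrite fill_comp; auto.
  - apply principal_cut; [now constructor|].
    destruct Hsub as [Hc1 Hc2]; intros K' E C' HB HE.
    assert (H : mix_free K'[[G ⊙ B2]] C') by now apply Hc1.
    change (mix_free K'[[(CDotR G (Hole V))[[Leaf B2]]]] C') in H.
    rewrite <- fill_comp in H.
    apply (Hc2 _ _ _ HE) in H; now rewrite fill_comp in H.
  - apply principal_cut; [now constructor|].
    destruct Hsub as [Hc1 Hc2]; intros K' C' H.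
    change (mix_free K'[[(CDotL (Hole V) B2)[[Leaf B1]]]] C') in H.
    rewrite <- fill_comp in H.
    apply (Hc1 _ _ _ H1) in H; rewrite fill_comp in H.
    change (mix_free K'[[(CDotR G (Hole V))[[Leaf B2]]]] C') in H.
    rewrite <- fill_comp in H.
    apply (Hc2 _ _ _ H2) in H; now rewrite fill_comp in H.
  - apply principal_cut; [now constructor|].
    destruct Hsub as [Hc1 Hc2]; intros K' C' H.
    change (mix_free K'[[(CAndL (Hole V) B2)[[Leaf B1]]]] C') in H.
    rewrite <- fill_comp in H.
    apply (Hc1 _ _ _ H1) in H; rewrite fill_comp in H.
    change (mix_free K'[[(CAndR G (Hole V))[[Leaf B2]]]] C') in H.
    rewrite <- fill_comp in H.
    apply (Hc2 _ _ _ H2) in H; rewrite fill_comp in H.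
    (* The cuts on [B1] and [B2] each leave a copy of [G], and contraction merges them. *)
    exact (mf_step _ (step_AndContr _) H).
  - intros HK; rewrite <- fill_comp; apply mf_OrL; rewrite fill_comp; auto.
  - apply principal_cut; [now constructor|].
    destruct Hsub as [Hc1 Hc2]; intros K' C' HB _; now apply Hc1.
  - apply principal_cut; [now constructor|].
    destruct Hsub as [Hc1 Hc2]; intros K' C' _ HB; now apply Hc2.
  - intros HK; rewrite <- fill_comp; apply (mf_step _ HXY).
    rewrite fill_comp; auto.
Qed.

Lemma cut_admissibility (V : Type) (A : formula V) : cut_admissible A.
Proof. induction A; apply cut_admissible_step; simpl; auto. Qed.

(** * From cut to mix *)

(** A mix is a sequence of single cuts, one per replaced leaf. Generalizing over the surrounding
    context lets the induction on [repl] descend into substructures. *)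
Lemma mix_admissible (V : Type) (A C : formula V) (D S S' : structure V) :
  mix_free D A -> repl A D S S' -> mix_free S C -> mix_free S' C.
Proof.
  intros HD HR.
  enough (H : forall K, mix_free K[[S]] C -> mix_free K[[S']] C)
    by exact (H (Hole V)).
  induction HR as [B | | X X' Y Y' _ IHX _ IHY | X X' Y Y' _ IHX _ IHY];
    intros K HK.
  - trivial.
  - now apply (cut_admissibility (A := A)).
  (* The left part is treated first, so the right part is then replaced beside [X']. *)
  - specialize (IHX (ctx_comp K (CDotL (Hole V) Y))).
    specialize (IHY (ctx_comp K (CDotR X' (Hole V)))).
    rewrite !fill_comp in IHX, IHY; simpl in IHX, IHY; auto.
  - specialize (IHX (ctx_comp K (CAndL (Hole V) Y))).
    specialize (IHY (ctx_comp K (CAndR X' (Hole V)))).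
    rewrite !fill_comp in IHX, IHY; simpl in IHX, IHY; auto.
Qed.

Lemma Lm_mix_free (V : Type) (G : structure V) (A : formula V) :
  Lm G A -> mix_free G A.
Proof.
  induction 1;
    try solve [constructor; trivial
              | eapply mf_step; [|eassumption]; constructor].
  now apply (mix_admissible (A := A) (D := D) (S := mfill M A));
    [| apply repl_mfill |].
Qed.

Theorem theorem7 (V : Type) (G : structure V) (A : formula V) :
  Lm G A ->
  exists d : Lm G A,
    forall C : formula V, In C (mix_formulas d) -> C = Bot \/ C = Top.
Proof.
  intros d0; destruct (mix_free_Lm (Lm_mix_free d0)) as [d Hd].
  (* No mix is left in [d], so the condition holds vacuously. *)
  exists d; rewrite Hd; intros C [].
Qed.
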